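(* Let $c$ be a real number with $-\pi/3<c<\pi/3$. The function $$D^*(s)=\frac{1}{2\pi i}\int_{c-i\infty}^{c+i\infty}F(z)\,u(z)^{-s}\,\mathrm{d}z ,\qquad F(z)=-\frac{4\sqrt3\cos z}{1+2\cos(2z)},\quad u(z)=\frac{(\pi-3z)(2\pi-3z)}{6\pi^2},$$ is an entire function of $s$.
   Context: The integral is along the vertical line $\operatorname{Re}(z)=c$, oriented upward. The power $u(z)^{-s}=\exp(-s\log u(z))$ is taken with the principal branch of the logarithm; its branch cuts in $z$ are the segment $[\pi/3,2\pi/3]$ and the vertical line $\operatorname{Re}(z)=\pi/2$, so $u(z)^{-s}$ is holomorphic for $\operatorname{Re}(z)<\pi/3$. The poles of $F$ are exactly the points $k\pi/3$ with $k\in\mathbb{Z}$, $3\nmid k$. *)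

(* Defs.v *)
From Stdlib Require Import Reals Lra.
From Coquelicot Require Import Coquelicot.
Open Scope R_scope.

Definition Cexp (z : C) : C :=
  (exp (Re z) * cos (Im z), exp (Re z) * sin (Im z)).

Definition Ccos (z : C) : C := ((Cexp (Ci * z) + Cexp (- (Ci * z))) / 2)%C.

(* Principal argument, in (-PI, PI]; the value at 0 is irrelevant. *)
Definition Carg (z : C) : R :=
  if Rle_dec 0 (Im z) then acos (Re z / Cmod z) else - acos (Re z / Cmod z).

Definition Clog (z : C) : C := (ln (Cmod z), Carg z).

Definition Cpower (w a : C) : C := Cexp (a * Clog w)%C.

Lemma Re_div_Cmod_bound (z : C) : z <> 0 -> -1 <= Re z / Cmod z <= 1.
Proof.
intros Hz. assert (H := proj1 (Cmod_gt_0 z) Hz).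
assert (H1 := re_le_Cmod z). apply Rabs_le_between in H1.
split; [apply Rle_div_r | apply Rle_div_l]; lra.
Qed.

Lemma Cexp_Clog (z : C) : z <> 0 -> Cexp (Clog z) = z.
Proof.
intros Hz. assert (Hm := proj1 (Cmod_gt_0 z) Hz).
assert (Hb := Re_div_Cmod_bound z Hz).
assert (H2 := Cmod2_alt z).
assert (Hs : Cmod z * sqrt (1 - (Re z / Cmod z)²) = Rabs (Im z)).
{ rewrite <- (Rabs_pos_eq (Cmod z)) at 1 by lra.
  rewrite <- sqrt_Rsqr_abs, <- sqrt_mult_alt by apply Rle_0_sqr.
  rewrite <- sqrt_Rsqr_abs. f_equal.
  transitivity (Cmod z ^ 2 - Re z ^ 2); [unfold Rsqr; field; lra|].
  rewrite H2. unfold Rsqr; ring. }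
assert (Hc : Cmod z * (Re z / Cmod z) = Re z) by (field; lra).
unfold Cexp, Clog, Carg. cbn [Re Im fst snd]. rewrite exp_ln by exact Hm.
destruct z as [x y]. cbn [Re Im fst snd] in *.
destruct (Rle_dec 0 y) as [Hy | Hy].
- rewrite cos_acos, sin_acos by exact Hb.
  rewrite Hc, Hs, Rabs_pos_eq by exact Hy. reflexivity.
- rewrite cos_neg, sin_neg, cos_acos, sin_acos by exact Hb.
  rewrite Ropp_mult_distr_r_reverse, Hc, Hs, Rabs_left by lra.
  f_equal; ring.
Qed.

Lemma Carg_bound (z : C) : z <> 0 -> - PI < Carg z <= PI.
Proof.
intros Hz. assert (Hb := Re_div_Cmod_bound z Hz).
assert (Ha := acos_bound (Re z / Cmod z)). assert (HP := PI_RGT_0).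
assert (He := Cexp_Clog z Hz).
unfold Cexp, Clog in He. cbn [Re Im fst snd] in He.
unfold Carg in *. destruct (Rle_dec 0 (Im z)) as [Hy | Hy]; [lra|].
split; [|lra].
destruct (Req_dec (acos (Re z / Cmod z)) PI) as [Hpi | Hpi]; [|lra].
exfalso. apply Hy. rewrite <- He. cbn [Im snd].
rewrite Hpi, sin_neg, sin_PI. lra.
Qed.

(* f (c + i t), as a function of t. *)
Definition on_vline (c : R) (f : C -> C) (t : R) : C := f (c, t).

(* Integral along Re z = c oriented upward (z = c + i t, dz = i dt), as an
   improper integral whose two endpoints tend to infinity independently. *)
Definition ex_vline_int (c : R) (f : C -> C) : Prop :=
  ex_RInt_gen (V := C_R_NormedModule) (on_vline c f)
    (Rbar_locally m_infty) (Rbar_locally p_infty).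

Definition vline_int (c : R) (f : C -> C) : C :=
  (Ci * RInt_gen (V := C_R_CompleteNormedModule) (on_vline c f)
          (Rbar_locally m_infty) (Rbar_locally p_infty))%C.

Definition entire (f : C -> C) : Prop :=
  forall s : C, ex_derive (K := C_AbsRing) (V := C_NormedModule) f s.

Definition F (z : C) : C :=
  (- (4 * sqrt 3 * Ccos z / (1 + 2 * Ccos (2 * z))))%C.

Definition u (z : C) : C :=
  ((PI - 3 * z) * (2 * PI - 3 * z) / (6 * PI ^ 2))%C.

Definition Dstar_integrand (s z : C) : C := (F z * Cpower (u z) (- s))%C.

Definition Dstar (c : R) (s : C) : C :=
  (/ (2 * PI * Ci) * vline_int c (Dstar_integrand s))%C.

(* Main.v *)
Require Import Defs.
From Stdlib Require Import Reals Lra.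
From Coquelicot Require Import Coquelicot.
Open Scope R_scope.

(* On the line Re z = c we have cos c > 1/2, and the factorization
   1 + 2 cos 2z = (2 cos z - 1)(2 cos z + 1) shows that F is continuous there
   and is O(exp (-|Im z|)).  Moreover u stays off the branch cut and
   |log u| <= B + 2 log (1 + |Im z|), so |F| exp (S |log u|) is integrable for
   every S.  Hence the integral of F exp (-s log u) converges for every s, and
   the quadratic remainder bound |e^w - 1 - w| <= 3 |w|^2 e^|w| allows
   differentiation in s under the integral sign. *)

(** * Improper integrals *)

(** Integrability on every segment turns the relational limit in [is_RInt_gen] into an ordinary
    limit of the function [RInt], to which the Cauchy criterion applies. *)
Lemma is_RInt_gen_RInt {V : CompleteNormedModule R_AbsRing}
  {Fa Fb : (R -> Prop) -> Prop} {FFa : Filter Fa} {FFb : Filter Fb}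
  (f : R -> V) (l : V) :
  (forall a b, ex_RInt f a b) ->
  (is_RInt_gen f Fa Fb l <->
   filterlim (fun ab => RInt f (fst ab) (snd ab)) (filter_prod Fa Fb) (locally l)).
Proof.
intros Hf; split.
- intros H P HP. specialize (H P HP). unfold filtermapi in H. unfold filtermap.
  revert H. apply filter_imp. intros [a b] [y [Hy HPy]].
  rewrite (is_RInt_unique _ _ _ _ Hy). exact HPy.
- intros H P HP. specialize (H P HP). unfold filtermap in H. unfold filtermapi.
  revert H. apply filter_imp. intros [a b] HPy.
  exists (RInt f a b). split; [apply RInt_correct, Hf | exact HPy].
Qed.

(** The absolute value on the right covers reversed endpoints, which occur when two truncations of
    an improper integral are compared. *)
Lemma norm_RInt_le_Rabs {V : CompleteNormedModule R_AbsRing} (f : R -> V) (g : R -> R) (a b : R) :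
  (forall t, norm (f t) <= g t) -> ex_RInt f a b -> ex_RInt g a b ->
  norm (RInt f a b) <= Rabs (RInt g a b).
Proof.
intros H Hf Hg.
assert (Hg' : forall x y, ex_RInt g x y -> is_RInt g x y (RInt g x y)).
{ intros. now apply (RInt_correct (V := R_CompleteNormedModule)). }
destruct (Rle_dec a b) as [Hab | Hab].
- eapply Rle_trans; [|apply Rle_abs].
  apply (norm_RInt_le f g a b); auto. now apply RInt_correct.
- apply ex_RInt_swap in Hf, Hg.
  replace (norm (RInt f a b)) with (norm (RInt f b a)).
  2: { rewrite <- (opp_RInt_swap f a b) by now apply ex_RInt_swap.
       exact (norm_opp (RInt f a b)). }
  replace (Rabs (RInt g a b)) with (Rabs (RInt g b a)).
  2: { rewrite <- (opp_RInt_swap (V := R_CompleteNormedModule) g a b) by now apply ex_RInt_swap.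
       exact (Rabs_Ropp (RInt g a b)). }
  eapply Rle_trans; [|apply Rle_abs].
  apply (norm_RInt_le f g b a); auto; [lra | now apply RInt_correct].
Qed.

Lemma minus_middle {G : AbelianGroup} (x y z : G) :
  plus x z = minus (plus x (plus y z)) y.
Proof.
unfold minus. rewrite (plus_comm y z), plus_assoc, <- (plus_assoc (plus x z)).
now rewrite plus_opp_r, plus_zero_r.
Qed.

(** Cauchy criterion on the product filter: the integrals of [f] over two truncations differ by two
    end pieces, each dominated by the same piece of [g], and these are small because the integral of
    [g] converges. *)
Lemma ex_RInt_gen_comparison {V : CompleteNormedModule R_AbsRing}
  {Fa Fb : (R -> Prop) -> Prop} {FFa : ProperFilter Fa} {FFb : ProperFilter Fb}
  (f : R -> V) (g : R -> R) :
  (forall a b, ex_RInt f a b) -> (forall a b, ex_RInt g a b) ->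
  (forall t, norm (f t) <= g t) ->
  ex_RInt_gen g Fa Fb -> ex_RInt_gen f Fa Fb.
Proof.
intros Hf Hg Hfg [l Hl].
apply (is_RInt_gen_RInt (V := R_CompleteNormedModule)) in Hl; [|exact Hg].
destruct (proj1 (filterlim_locally_cauchy (F := filter_prod Fa Fb)
  (fun ab => RInt f (fst ab) (snd ab)))) as [y Hy].
2: { exists y. apply is_RInt_gen_RInt; auto. }
intros eps.
(* Each end piece of [g] is a difference of two integrals within [eps / 5] of [l], hence at most
   [2 * (eps / 5)]; the two together stay strictly below [eps]. *)
assert (He : 0 < eps / 5) by (pose proof (cond_pos eps); lra).
specialize (Hl _ (locally_ball l (mkposreal _ He))).
destruct Hl as [Q T HQ HT HQT].
exists (fun ab => Q (fst ab) /\ T (snd ab)). split.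
{ exists Q T; auto. }
intros [a b] [a' b'] [Qa Tb] [Qa' Tb']. cbn [fst snd] in *.
set (I := fun x y : R => RInt (V := R_CompleteNormedModule) g x y : R).
assert (Hc : forall x y, Q x -> T y -> Rabs (I x y - (l : R)) < eps / 5).
{ intros x y Qx Ty. exact (HQT x y Qx Ty). }
assert (Ch : forall x y z, I x y + I y z = I x z).
{ intros. apply (RInt_Chasles (V := R_CompleteNormedModule) g); auto. }
apply (norm_compat1 (V := V)).
apply Rle_lt_trans with (norm (plus (RInt f a' a) (RInt f b b'))).
1: right; apply f_equal; symmetry.
2: { assert (H1 : norm (RInt f a' a) <= Rabs (I a' a)) by (apply norm_RInt_le_Rabs; auto).
  assert (H2 : norm (RInt f b b') <= Rabs (I b b')) by (apply norm_RInt_le_Rabs; auto).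
  eapply Rle_lt_trans; [apply (norm_triangle (V := V))|].
  clearbody I.
  pose proof (Hc a b Qa Tb) as E1. pose proof (Hc a' b Qa' Tb) as E2.
  pose proof (Hc a b' Qa Tb') as E3.
  rewrite <- (Ch a' a b) in E2. rewrite <- (Ch a b b') in E3.
  assert (Rabs (I a' a) <= 2 * (eps / 5)).
  { apply Rabs_def2 in E1. apply Rabs_def2 in E2. apply Rabs_le. lra. }
  assert (Rabs (I b b') <= 2 * (eps / 5)).
  { apply Rabs_def2 in E1. apply Rabs_def2 in E3. apply Rabs_le. lra. }
  lra. }
change (plus (RInt f a' a) (RInt f b b') = minus (RInt f a' b') (RInt f a b)).
rewrite <- (RInt_Chasles f a' a b') by auto.
rewrite <- (RInt_Chasles f a b b') by auto.
apply (minus_middle (G := CompleteNormedModule.AbelianGroup R_AbsRing V)).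
Qed.

(** [C_R_NormedModule] has real scalars, so a complex factor is handled by components on segments
    and then carried to the limit by continuity of multiplication by [k]. *)
Lemma is_RInt_gen_Cmult {Fa Fb : (R -> Prop) -> Prop} {FFa : Filter Fa} {FFb : Filter Fb}
  (f : R -> C) (k l : C) :
  is_RInt_gen (V := C_R_NormedModule) f Fa Fb l ->
  is_RInt_gen (V := C_R_NormedModule) (fun t => k * f t)%C Fa Fb (k * l)%C.
Proof.
assert (Hk : forall a b y, is_RInt (V := C_R_NormedModule) f a b y ->
  is_RInt (V := C_R_NormedModule) (fun t => k * f t)%C a b (k * y)%C).
{ intros a b y Hy.
  assert (Hre := is_RInt_fct_extend_fst (U:=R_NormedModule) (V:=R_NormedModule) f a b y Hy).
  assert (Him := is_RInt_fct_extend_snd (U:=R_NormedModule) (V:=R_NormedModule) f a b y Hy).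
  apply (is_RInt_fct_extend_pair (U:=R_NormedModule) (V:=R_NormedModule)); cbn.
  - apply (is_RInt_minus (V:=R_NormedModule)); apply (is_RInt_scal (V:=R_NormedModule)); auto.
  - apply (is_RInt_plus (V:=R_NormedModule)); apply (is_RInt_scal (V:=R_NormedModule)); auto. }
intros H P HP. unfold filtermapi.
assert (HP' := filterlim_scal_r (V := C_NormedModule) k l P HP).
specialize (H _ HP'). unfold filtermapi in H.
revert H. apply filter_imp. intros [a b] [y [Hy HPy]].
exists (k * y)%C. split; auto.
Qed.

(** * The arctangent and the integral of 1/(1+t^2) *)

Lemma is_derive_atan_inv (x : R) : is_derive atan x (/ (1 + x ^ 2)).
Proof.
apply is_derive_Reals, derivable_pt_lim_atan.
Qed.

Lemma atan_lim_p_infty : filterlim atan (Rbar_locally p_infty) (locally (PI / 2)).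
Proof.
intros P [eps HP]. pose proof (PI_RGT_0) as HPI.
set (d := Rmin (pos eps) (PI / 2) / 2).
assert (Hd : 0 < d /\ d < eps /\ d < PI / 2).
{ pose proof (cond_pos eps). assert (0 < Rmin eps (PI/2)) by (apply Rmin_pos; lra).
  pose proof (Rmin_l eps (PI/2)). pose proof (Rmin_r eps (PI/2)). unfold d. lra. }
(* Beyond this threshold [atan x] exceeds [PI / 2 - d], where [d < eps]; the bound [d < PI / 2]
   keeps [PI / 2 - d] in the range where [atan] inverts [tan]. *)
exists (tan (PI / 2 - d)). intros x Hx. apply HP.
apply atan_increasing in Hx. rewrite atan_tan in Hx by lra.
pose proof (atan_bound x).
apply Rabs_def1; unfold minus, plus, opp; simpl; lra.
Qed.

Lemma atan_lim_m_infty : filterlim atan (Rbar_locally m_infty) (locally (- (PI / 2))).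
Proof.
apply filterlim_ext with (fun x => opp (atan (opp x))).
{ intros x. unfold opp; simpl. rewrite atan_opp. ring. }
eapply filterlim_comp; [|apply (filterlim_opp (V := R_NormedModule))].
eapply filterlim_comp; [|exact atan_lim_p_infty].
exact (filterlim_Rbar_opp m_infty).
Qed.

(** Multiples of this function are the integrable majorants for all the complex integrals below. *)
Lemma is_RInt_gen_Cauchy :
  is_RInt_gen (V := R_NormedModule) (fun t => / (1 + t ^ 2))
    (Rbar_locally m_infty) (Rbar_locally p_infty) PI.
Proof.
replace PI with (PI / 2 - - (PI / 2)) by field.
apply is_RInt_gen_ext with (Derive atan).
{ apply filter_forall. intros ab x _. apply is_derive_unique, is_derive_atan_inv. }
apply is_RInt_gen_Derive.
- apply filter_forall. intros ab x _. eexists. apply is_derive_atan_inv.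
- apply filter_forall. intros ab x _.
  apply continuous_ext with (fun t => / (1 + t ^ 2)).
  { intros t. symmetry. apply is_derive_unique, is_derive_atan_inv. }
  apply (ex_derive_continuous (V := R_NormedModule)). auto_derive. nra.
- exact atan_lim_m_infty.
- exact atan_lim_p_infty.
Qed.

(** * Estimates and continuity for the complex exponential *)

Lemma Cmod_le_Rabs_plus (z : C) : Cmod z <= Rabs (Re z) + Rabs (Im z).
Proof.
pose proof (Rabs_pos (Re z)). pose proof (Rabs_pos (Im z)). pose proof (Cmod_ge_0 z).
apply Rsqr_incr_0; [|lra|lra].
rewrite !Rsqr_pow2, Cmod2_alt, <- (pow2_abs (Re z)), <- (pow2_abs (Im z)). nra.
Qed.

Lemma Cmod_Cexp (w : C) : Cmod (Cexp w) = exp (Re w).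
Proof.
pose proof (exp_pos (Re w)). pose proof (Cmod_ge_0 (Cexp w)).
apply Rsqr_inj; [lra | lra |].
rewrite !Rsqr_pow2, Cmod2_alt. unfold Cexp; cbn [Re Im fst snd].
pose proof (sin2_cos2 (Im w)). unfold Rsqr in *. nra.
Qed.

Lemma exp_increasing_le (x y : R) : x <= y -> exp x <= exp y.
Proof.
intros [H | ->]; [left; now apply exp_increasing | apply Rle_refl].
Qed.

Lemma Cmod_Cexp_le (w : C) : Cmod (Cexp w) <= exp (Cmod w).
Proof.
rewrite Cmod_Cexp. apply exp_increasing_le. eapply Rle_trans; [apply Rle_abs | apply re_le_Cmod].
Qed.

Lemma Cexp_plus (z w : C) : Cexp (z + w) = (Cexp z * Cexp w)%C.
Proof.
unfold Cexp, Cplus, Cmult, Re, Im; cbn [fst snd].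
rewrite exp_plus, cos_plus, sin_plus.
apply injective_projections; cbn [fst snd]; ring.
Qed.

(** Both signs follow from [1 + x <= exp x], taken at [x] and at [- x], with
    [exp x * exp (- x) = 1]. *)
Lemma Rabs_exp_minus_1_le (x : R) : Rabs (exp x - 1) <= Rabs x * exp (Rabs x).
Proof.
pose proof (exp_ineq1_le x). pose proof (exp_ineq1_le (- x)).
assert (exp x * exp (- x) = 1) by (rewrite <- exp_plus, Rplus_opp_r; apply exp_0).
pose proof (exp_pos x). pose proof (exp_pos (- x)).
unfold Rabs at 2 3. destruct (Rcase_abs x); apply Rabs_le; nra.
Qed.

(** The remainder is nonnegative by the tangent-line inequality, and at most [x * (exp x - 1)]
    because [exp x * (1 - x) <= 1]; the first-order bound then supplies the second factor
    [Rabs x]. *)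
Lemma Rabs_exp_minus_1_minus_le (x : R) : Rabs (exp x - 1 - x) <= x ^ 2 * exp (Rabs x).
Proof.
pose proof (Rabs_exp_minus_1_le x). pose proof (exp_ineq1_le x).
pose proof (exp_ineq1_le (- x)).
assert (exp x * exp (- x) = 1) by (rewrite <- exp_plus, Rplus_opp_r; apply exp_0).
pose proof (exp_pos x). pose proof (exp_pos (- x)). pose proof (Rabs_pos x).
assert (exp x - 1 - x <= x * (exp x - 1)) by nra.
assert (x * (exp x - 1) <= Rabs x * Rabs (exp x - 1)).
{ rewrite <- Rabs_mult. apply Rle_abs. }
assert (Rabs x * Rabs (exp x - 1) <= Rabs x * (Rabs x * exp (Rabs x))).
{ apply Rmult_le_compat_l; lra. }
rewrite <- (pow2_abs x). rewrite Rabs_pos_eq by lra. lra.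
Qed.

Lemma Rabs_sin_le (y : R) : Rabs (sin y) <= Rabs y.
Proof.
destruct (MVT_gen sin 0 y cos) as [x [_ Hx]].
- intros x _. auto_derive; [exact I | ring].
- intros x _. apply continuity_sin.
- rewrite sin_0 in Hx. replace (sin y) with (cos x * y) by lra.
  rewrite Rabs_mult. pose proof (COS_bound x). pose proof (Rabs_pos y).
  assert (Rabs (cos x) <= 1) by (apply Rabs_le; lra). nra.
Qed.

Lemma one_minus_cos (y : R) : 1 - cos y = 2 * (sin (y / 2)) ^ 2.
Proof.
replace (cos y) with (cos (2 * (y / 2))) by (f_equal; field).
rewrite cos_2a_sin. ring.
Qed.

Lemma Rabs_cos_minus_1_le (y : R) : Rabs (cos y - 1) <= y ^ 2.
Proof.
assert (H : sin (y / 2) ^ 2 <= (y / 2) ^ 2).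
{ rewrite <- (pow2_abs (sin _)), <- (pow2_abs (y / 2)).
  apply pow_incr. split; [apply Rabs_pos | apply Rabs_sin_le]. }
pose proof (pow2_ge_0 (sin (y / 2))).
rewrite Rabs_minus_sym, one_minus_cos, Rabs_pos_eq; nra.
Qed.

(** The mean value theorem gives [sin y - y = (cos x - 1) * y] with [x] between 0 and [y], and
    [1 - cos x = 2 * sin (x / 2) ^ 2] is at most [Rabs y]. Quadratic order suffices for the complex
    remainder. *)
Lemma Rabs_sin_minus_id_le (y : R) : Rabs (sin y - y) <= y ^ 2.
Proof.
destruct (MVT_gen (fun x => sin x - x) 0 y (fun x => cos x - 1)) as [x [Hx E]].
- intros x _. auto_derive; [exact I | ring].
- intros x _. apply derivable_continuous_pt, ex_derive_Reals_0. auto_derive. exact I.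
- rewrite sin_0 in E. replace (sin y - y) with ((cos x - 1) * y) by lra.
  rewrite Rabs_mult, <- (pow2_abs y), Rabs_minus_sym, one_minus_cos.
  rewrite Rabs_pos_eq by (pose proof (pow2_ge_0 (sin (x / 2))); lra).
  pose proof (Rabs_sin_le (x / 2)) as H. pose proof (SIN_bound (x / 2)).
  rewrite <- (pow2_abs (sin (x / 2))).
  assert (Rabs (sin (x / 2)) <= 1) by (apply Rabs_le; lra).
  pose proof (Rabs_pos (sin (x / 2))). pose proof (Rabs_pos y).
  assert (Rabs (x / 2) <= Rabs y / 2).
  { revert Hx. unfold Rmin, Rmax, Rabs. repeat destruct Rcase_abs; destruct Rle_dec; lra. }
  assert (2 * Rabs (sin (x / 2)) ^ 2 <= Rabs y) by nra. nra.
Qed.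

(** Real and imaginary parts split into the one-variable remainders above and a cross term, absorbed
    by [Rabs y * Rabs x <= x ^ 2 + y ^ 2]. The sum has at most two copies of [x ^ 2] and three of
    [y ^ 2], whence the constant 3. *)
Lemma Cmod_Cexp_remainder_le (w : C) :
  Cmod (Cexp w - 1 - w)%C <= 3 * Cmod w ^ 2 * exp (Cmod w).
Proof.
destruct w as [x y].
assert (Hx := re_le_Cmod (x, y)). assert (H2 := Cmod2_alt (x, y)).
cbn [Re Im fst snd] in *.
apply Rle_trans with (3 * Cmod (x, y) ^ 2 * exp (Rabs x)).
2: { apply Rmult_le_compat_l; [pose proof (pow2_ge_0 (Cmod (x, y))); lra|].
     now apply exp_increasing_le. }
rewrite H2. clear H2.
eapply Rle_trans; [apply Cmod_le_Rabs_plus|].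
cbn [Re Im fst snd Cexp Cminus Cplus Copp RtoC].
replace (exp x * cos y + - (1) + - x) with (exp x * (cos y - 1) + (exp x - 1 - x)) by ring.
replace (exp x * sin y + - (0) + - y) with (exp x * (sin y - y) + y * (exp x - 1)) by ring.
assert (E : 0 < exp x <= exp (Rabs x)).
{ split; [apply exp_pos | apply exp_increasing_le, Rle_abs]. }
assert (H1 : Rabs (exp x * (cos y - 1)) <= exp (Rabs x) * y ^ 2).
{ rewrite Rabs_mult, Rabs_pos_eq by lra.
  apply Rmult_le_compat; try apply Rabs_pos; try lra. apply Rabs_cos_minus_1_le. }
assert (H2 : Rabs (exp x * (sin y - y)) <= exp (Rabs x) * y ^ 2).
{ rewrite Rabs_mult, Rabs_pos_eq by lra.
  apply Rmult_le_compat; try apply Rabs_pos; try lra. apply Rabs_sin_minus_id_le. }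
assert (H3 := Rabs_exp_minus_1_minus_le x).
assert (H4 : Rabs (y * (exp x - 1)) <= Rabs y * (Rabs x * exp (Rabs x))).
{ rewrite Rabs_mult. apply Rmult_le_compat_l; [apply Rabs_pos | apply Rabs_exp_minus_1_le]. }
assert (H5 : Rabs y * Rabs x <= x ^ 2 + y ^ 2).
{ rewrite <- (pow2_abs x), <- (pow2_abs y).
  pose proof (Rabs_pos x). pose proof (Rabs_pos y). nra. }
apply Rmult_le_compat_r with (r := exp (Rabs x)) in H5; [|lra].
pose proof (Rabs_triang (exp x * (cos y - 1)) (exp x - 1 - x)).
pose proof (Rabs_triang (exp x * (sin y - y)) (y * (exp x - 1))).
assert (0 <= x ^ 2 * exp (Rabs x)).
{ apply Rmult_le_pos; [apply pow2_ge_0 | lra]. }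
lra.
Qed.

(** * Continuity into the complex plane and a criterion for complex differentiability *)

Lemma continuous_C_iff {U : UniformSpace} (f : U -> C) (x : U) :
  continuous (U := C_UniformSpace) f x <->
  continuous (fun y => Re (f y)) x /\ continuous (fun y => Im (f y)) x.
Proof.
split.
- intros H. split.
  + apply (continuous_comp f Re); [exact H|].
    destruct (f x). apply continuous_fst.
  + apply (continuous_comp f Im); [exact H|].
    destruct (f x). apply continuous_snd.
- intros [Hr Hi].
  apply (continuous_ext (U := C_UniformSpace) (fun y => (Re (f y), Im (f y)))).
  { intros y. now destruct (f y). }
  apply (continuous_comp_2 (X := C_UniformSpace) (fun y => Re (f y)) (fun y => Im (f y))
    (fun a b => (a, b))); auto.
  apply (continuous_ext (U := C_UniformSpace) (fun p => p)); [now intros []|].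
  apply continuous_id.
Qed.

Lemma continuous_Cmult {U : UniformSpace} (f g : U -> C) (x : U) :
  continuous (U := C_UniformSpace) f x -> continuous (U := C_UniformSpace) g x ->
  continuous (U := C_UniformSpace) (fun y => f y * g y)%C x.
Proof.
rewrite !continuous_C_iff. intros [Hf1 Hf2] [Hg1 Hg2]. split; cbn.
- apply (continuous_minus (V := R_NormedModule)); apply (continuous_mult (K := R_AbsRing)); auto.
- apply (continuous_plus (V := R_NormedModule)); apply (continuous_mult (K := R_AbsRing)); auto.
Qed.

Lemma continuous_Cexp {U : UniformSpace} (f : U -> C) (x : U) :
  continuous (U := C_UniformSpace) f x ->
  continuous (U := C_UniformSpace) (fun y => Cexp (f y)) x.
Proof.
rewrite !continuous_C_iff. intros [Hf1 Hf2]. cbn. split.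
- apply (continuous_mult (K := R_AbsRing)).
  + apply (continuous_comp _ exp); [exact Hf1 | apply continuous_exp].
  + apply (continuous_comp _ cos); [exact Hf2 | apply continuous_cos].
- apply (continuous_mult (K := R_AbsRing)).
  + apply (continuous_comp _ exp); [exact Hf1 | apply continuous_exp].
  + apply (continuous_comp _ sin); [exact Hf2 | apply continuous_sin].
Qed.

(** A quadratic remainder is o(|h|), so differentiating under the integral sign reduces to one
    uniform estimate, with no interchange of limits. *)
Lemma is_derive_C_quadratic (f : C -> C) (s D : C) (M : R) :
  (forall h : C, Cmod h <= 1 -> Cmod (f (s + h)%C - f s - h * D)%C <= M * Cmod h ^ 2) ->
  is_derive (K := C_AbsRing) (V := C_NormedModule) f s D.
Proof.
intros H. split.
{ apply (is_linear_scal_l (K := C_AbsRing) (V := C_NormedModule)). }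
intros x Hx.
apply (is_filter_lim_locally_unique (K := C_AbsRing) (V := AbsRing_NormedModule C_AbsRing)) in Hx.
subst x. intros eps.
assert (HM : 0 < Rabs M + 1) by (pose proof (Rabs_pos M); lra).
pose proof (cond_pos eps) as He.
(* The 1 makes the hypothesis available; the other bound gives [M * Cmod h <= eps], with
   [Rabs M + 1] as a positive divisor even when [M = 0]. *)
assert (Hd : 0 < Rmin 1 (eps / (Rabs M + 1))).
{ apply Rmin_pos; [lra | now apply Rdiv_lt_0_compat]. }
exists (mkposreal _ Hd). intros y Hy.
change (Cmod (y - s)%C < Rmin 1 (eps / (Rabs M + 1))) in Hy.
change (Cmod (f y - f s - (y - s) * D)%C <= eps * Cmod (y - s)%C).
assert (H1 : Cmod (y - s)%C <= 1) by (pose proof (Rmin_l 1 (eps / (Rabs M + 1))); lra).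
assert (H2 : Cmod (y - s)%C < eps / (Rabs M + 1)).
{ pose proof (Rmin_r 1 (eps / (Rabs M + 1))); lra. }
apply Rlt_div_r in H2; [|lra].
specialize (H _ H1).
replace (s + (y - s))%C with (y : C) in H by (generalize (y : C); intros z; ring).
pose proof (Cmod_ge_0 (y - s)). pose proof (Rle_abs M).
eapply Rle_trans; [exact H|].
assert (M * Cmod (y - s)%C <= eps) by nra. nra.
Qed.

(** * Entire functions defined by integrals *)

Lemma ex_RInt_gen_Cauchy_bound (f : R -> C) (K : R) :
  (forall t, continuous (U := C_UniformSpace) f t) ->
  (forall t, Cmod (f t) <= K * / (1 + t ^ 2)) ->
  ex_RInt_gen (V := C_R_NormedModule) f (Rbar_locally m_infty) (Rbar_locally p_infty).
Proof.
intros Hc Hb.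
apply (ex_RInt_gen_comparison (V := C_R_CompleteNormedModule) f (fun t => K * / (1 + t ^ 2))).
- intros a b. apply (ex_RInt_continuous (V := C_R_CompleteNormedModule)). intros t _. apply Hc.
- intros a b. apply (ex_RInt_continuous (V := R_CompleteNormedModule)). intros t _.
  apply (ex_derive_continuous (V := R_NormedModule)). auto_derive. nra.
- intros t. rewrite <- Cmod_norm. apply Hb.
- exists (K * PI). apply (is_RInt_gen_scal (V := R_NormedModule)), is_RInt_gen_Cauchy.
Qed.

Lemma is_RInt_gen_Cauchy_bound (f : R -> C) (K : R) (l : C) :
  (forall t, Cmod (f t) <= K * / (1 + t ^ 2)) ->
  is_RInt_gen (V := C_R_NormedModule) f (Rbar_locally m_infty) (Rbar_locally p_infty) l ->
  Cmod l <= K * PI.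
Proof.
intros Hb Hl. rewrite Cmod_norm.
refine (RInt_gen_norm (V := C_R_CompleteNormedModule) f (fun t => K * / (1 + t ^ 2)) l (K * PI)
  _ _ Hl _).
(* The norm inequality requires ordered endpoints, which holds once they lie on either side of 0. *)
- exists (fun a => a < 0) (fun b => 0 < b); [now exists 0 | now exists 0 |].
  cbn; intros; lra.
- apply filter_forall. intros ab t _. rewrite <- Cmod_norm. apply Hb.
- apply (is_RInt_gen_scal (V := R_NormedModule)), is_RInt_gen_Cauchy.
Qed.

(** To be used with [G] for F and [L] for log u on the line. Having the bound for every [S] lets the
    powers of [L] produced by differentiation in [s] be absorbed by raising [S]. Convergence is
    stated separately because [RInt_gen] has a value even for a divergent integral. *)
Lemma entire_RInt_gen_Cexp (G L : R -> C) (k : C) :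
  (forall t, continuous (U := C_UniformSpace) G t) ->
  (forall t, continuous (U := C_UniformSpace) L t) ->
  (forall S, exists K, forall t,
    Cmod (G t) * exp (S * Cmod (L t)) <= K * / (1 + t ^ 2)) ->
  (forall s, ex_RInt_gen (V := C_R_NormedModule) (fun t => G t * Cexp (- s * L t))%C
     (Rbar_locally m_infty) (Rbar_locally p_infty)) /\
  entire (fun s => k * RInt_gen (V := C_R_CompleteNormedModule)
     (fun t => G t * Cexp (- s * L t))%C
     (Rbar_locally m_infty) (Rbar_locally p_infty))%C.
Proof.
intros HG HL HK.
assert (HcE : forall s t, continuous (U := C_UniformSpace) (fun t => G t * Cexp (- s * L t))%C t).
{ intros s t. apply continuous_Cmult; [apply HG|]. apply continuous_Cexp, continuous_Cmult.
  - apply continuous_const.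
  - apply HL. }
assert (HbE : forall s t, Cmod (G t * Cexp (- s * L t))%C <= Cmod (G t) * exp (Cmod s * Cmod (L t))).
{ intros s t. rewrite Cmod_mult. apply Rmult_le_compat_l; [apply Cmod_ge_0|].
  eapply Rle_trans; [apply Cmod_Cexp_le|]. rewrite Cmod_mult, Cmod_opp. apply Rle_refl. }
assert (Hex : forall s, ex_RInt_gen (V := C_R_NormedModule) (fun t => G t * Cexp (- s * L t))%C
     (Rbar_locally m_infty) (Rbar_locally p_infty)).
{ intros s. destruct (HK (Cmod s)) as [K HKs].
  apply ex_RInt_gen_Cauchy_bound with K; [apply HcE|].
  intros t. eapply Rle_trans; [apply HbE | apply HKs]. }
split; [exact Hex|].
intros s.
(* This integrand is the formal derivative in [s]. Its extra factor is at most [exp (Cmod (L t))],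
   which costs one unit of [S]. *)
assert (Hex' : ex_RInt_gen (V := C_R_NormedModule)
  (fun t => - L t * (G t * Cexp (- s * L t)))%C
     (Rbar_locally m_infty) (Rbar_locally p_infty)).
{ destruct (HK (Cmod s + 1)) as [K HKs].
  apply ex_RInt_gen_Cauchy_bound with K.
  - intros t. apply continuous_Cmult; [|apply HcE].
    apply (continuous_ext (U := C_UniformSpace) (fun y => (- (1)) * L y)%C).
    { intros y. change (- (1) * L y = - L y)%C. ring. }
    apply continuous_Cmult; [apply continuous_const | apply HL].
  - intros t. rewrite Cmod_mult, Cmod_opp.
    eapply Rle_trans; [|apply HKs].
    rewrite Rmult_plus_distr_r, exp_plus, Rmult_1_l.
    pose proof (HbE s t). pose proof (Cmod_ge_0 (L t)). pose proof (exp_ineq1_le (Cmod (L t))).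
    pose proof (Cmod_ge_0 (G t * Cexp (- s * L t))%C).
    rewrite <- Rmult_assoc, (Rmult_comm (Cmod (L t))).
    apply Rmult_le_compat; lra. }
destruct Hex' as [D HD].
(* Three extra units of [S]: two for [Cmod (L t) ^ 2], and one for [exp (Cmod h * Cmod (L t))] with
   [Cmod h <= 1]. *)
destruct (HK (Cmod s + 3)) as [K HKs].
exists (k * D)%C.
apply is_derive_C_quadratic with (Cmod k * (3 * K * PI)).
intros h Hh.
set (J := fun s => RInt_gen (V := C_R_CompleteNormedModule)
     (fun t => G t * Cexp (- s * L t))%C
     (Rbar_locally m_infty) (Rbar_locally p_infty)).
change (Cmod (k * J (s + h)%C - k * J s - h * (k * D))%C <= Cmod k * (3 * K * PI) * Cmod h ^ 2).
replace (k * J (s + h)%C - k * J s - h * (k * D))%C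
  with (k * (J (s + h)%C - J s - h * D))%C by ring.
rewrite Cmod_mult, Rmult_assoc. apply Rmult_le_compat_l; [apply Cmod_ge_0|].
replace (3 * K * PI * Cmod h ^ 2) with (3 * Cmod h ^ 2 * K * PI) by ring.
assert (HJ : forall s, is_RInt_gen (V := C_R_NormedModule) (fun t => G t * Cexp (- s * L t))%C
     (Rbar_locally m_infty) (Rbar_locally p_infty) (J s)).
{ intros s'. apply (RInt_gen_correct (V := C_R_CompleteNormedModule)), Hex. }
apply (is_RInt_gen_Cauchy_bound (fun t => G t * Cexp (- (s + h) * L t) - G t * Cexp (- s * L t)
  - h * (- L t * (G t * Cexp (- s * L t))))%C).
- intros t.
  (* By multiplicativity of [Cexp], the integrand at [s] factors out and leaves the second-order
     remainder at [w = - h * L t]. *)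
  replace (G t * Cexp (- (s + h) * L t) - G t * Cexp (- s * L t)
    - h * (- L t * (G t * Cexp (- s * L t))))%C
    with ((G t * Cexp (- s * L t)) * (Cexp (- h * L t) - 1 - (- h * L t)))%C.
  2: { replace (- (s + h) * L t)%C with (- s * L t + - h * L t)%C by ring.
       rewrite Cexp_plus. ring. }
  rewrite Cmod_mult.
  eapply Rle_trans.
  { apply Rmult_le_compat; [apply Cmod_ge_0 | apply Cmod_ge_0 | apply HbE |].
    apply Cmod_Cexp_remainder_le. }
  rewrite Cmod_mult, Cmod_opp.
  specialize (HKs t).
  rewrite Rmult_plus_distr_r, exp_plus in HKs.
  apply Rmult_le_compat_l with (r := 3 * Cmod h ^ 2) in HKs.
  2: { pose proof (pow2_ge_0 (Cmod h)). lra. }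
  rewrite (Rmult_assoc (3 * Cmod h ^ 2) K).
  eapply Rle_trans; [|exact HKs].
  rewrite (Rmult_comm (Cmod (G t))), Rpow_mult_distr.
  assert (E : Cmod (L t) ^ 2 * exp (Cmod h * Cmod (L t)) <= exp (3 * Cmod (L t))).
  { replace (3 * Cmod (L t)) with (Cmod (L t) + Cmod (L t) + Cmod (L t)) by ring.
    rewrite !exp_plus.
    pose proof (Cmod_ge_0 (L t)). pose proof (exp_ineq1_le (Cmod (L t))).
    apply Rmult_le_compat; [apply pow2_ge_0 | left; apply exp_pos | nra |].
    apply exp_increasing_le. nra. }
  pose proof (Cmod_ge_0 (G t)) as HG0. pose proof (exp_pos (Cmod s * Cmod (L t))).
  pose proof (Cmod_ge_0 h).
  apply Rmult_le_compat_l with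
    (r := 3 * Cmod h ^ 2 * (Cmod (G t) * exp (Cmod s * Cmod (L t)))) in E.
  2: { repeat apply Rmult_le_pos; lra. }
  lra.
- apply (is_RInt_gen_minus (V := C_R_NormedModule)).
  + apply (is_RInt_gen_minus (V := C_R_NormedModule)); apply HJ.
  + apply is_RInt_gen_Cmult, HD.
Qed.

(** * Continuity of the complex elementary functions *)

Lemma continuous_Cplus {U : UniformSpace} (f g : U -> C) (x : U) :
  continuous (U := C_UniformSpace) f x -> continuous (U := C_UniformSpace) g x ->
  continuous (U := C_UniformSpace) (fun y => f y + g y)%C x.
Proof. apply (continuous_plus (V := C_R_NormedModule)). Qed.

Lemma continuous_Copp {U : UniformSpace} (f : U -> C) (x : U) :
  continuous (U := C_UniformSpace) f x ->
  continuous (U := C_UniformSpace) (fun y => - f y)%C x.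
Proof. apply (continuous_opp (V := C_R_NormedModule)). Qed.

Lemma continuous_Cinv {U : UniformSpace} (f : U -> C) (x : U) :
  continuous (U := C_UniformSpace) f x -> f x <> 0 ->
  continuous (U := C_UniformSpace) (fun y => / f y)%C x.
Proof.
rewrite !continuous_C_iff. intros [Hr Hi] H0.
assert (Hn : continuous (fun y => fst (f y) ^ 2 + snd (f y) ^ 2) x).
{ apply (continuous_plus (V := R_NormedModule)).
  - apply (continuous_comp (fun y => fst (f y)) (fun r => r ^ 2)); [exact Hr|].
    apply (ex_derive_continuous (V := R_NormedModule)). auto_derive. exact I.
  - apply (continuous_comp (fun y => snd (f y)) (fun r => r ^ 2)); [exact Hi|].
    apply (ex_derive_continuous (V := R_NormedModule)). auto_derive. exact I. }
assert (Hn0 : fst (f x) ^ 2 + snd (f x) ^ 2 <> 0).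
{ pose proof (Cmod2_alt (f x)) as E. unfold Re, Im in E. rewrite <- E.
  apply Cmod_gt_0 in H0. nra. }
assert (Hv := continuous_comp _ Rinv x Hn (continuous_Rinv _ Hn0)).
split; cbn [Cinv Re Im fst snd]; apply (continuous_mult (K := R_AbsRing)); auto.
now apply (continuous_opp (V := R_NormedModule)).
Qed.

Lemma continuous_Ccos {U : UniformSpace} (f : U -> C) (x : U) :
  continuous (U := C_UniformSpace) f x ->
  continuous (U := C_UniformSpace) (fun y => Ccos (f y)) x.
Proof.
intros Hf. unfold Ccos, Cdiv.
assert (Hi : continuous (U := C_UniformSpace) (fun y => Ci * f y)%C x).
{ apply continuous_Cmult; [apply continuous_const | exact Hf]. }
apply continuous_Cmult; [|apply continuous_const].
apply continuous_Cplus; apply continuous_Cexp; [|apply continuous_Copp]; exact Hi.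
Qed.

Lemma continuous_Cmod (z : C) : continuous (T := C_UniformSpace) Cmod z.
Proof.
apply (continuous_ext (T := C_UniformSpace) (fun y : C_R_NormedModule => norm y)).
{ intros y. symmetry. apply Cmod_norm. }
apply (filterlim_norm (V := C_R_NormedModule)).
Qed.

(* The condition [0 < Cmod z + Re z] says that [z] lies off the branch cut. *)
Lemma Carg_atan (z : C) :
  0 < Cmod z + Re z -> Carg z = 2 * atan (Im z / (Cmod z + Re z)).
Proof.
intros H.
assert (Hz : z <> 0).
{ intros ->. rewrite Cmod_0 in H. cbn in H. lra. }
assert (Hm := proj1 (Cmod_gt_0 z) Hz).
assert (He := Cexp_Clog z Hz). assert (Hb := Carg_bound z Hz).
unfold Cexp, Clog in He. cbn [Re Im fst snd] in He. rewrite exp_ln in He by exact Hm.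
(* Half-angle formulas: [Cmod z + Re z] and [Im z] are [2 * Cmod z * cos a] times [cos a] and
   [sin a], so their quotient is [tan a]; positivity of the former excludes [a = PI / 2]. *)
set (a := Carg z / 2).
assert (Ha : Carg z = 2 * a) by (unfold a; field).
rewrite Ha in *. clearbody a.
rewrite cos_2a_cos, sin_2a in He.
assert (Hre : Cmod z + Re z = 2 * Cmod z * cos a ^ 2) by (rewrite <- He at 2; cbn [Re fst]; ring).
assert (Him : Im z = 2 * Cmod z * sin a * cos a) by (rewrite <- He at 1; cbn [Im snd]; ring).
assert (Hc : cos a <> 0).
{ intros E. rewrite Hre, E in H. lra. }
f_equal. rewrite Hre, Him.
replace (2 * Cmod z * sin a * cos a / (2 * Cmod z * cos a ^ 2)) with (tan a)
  by (unfold tan; field; lra).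
symmetry. apply atan_tan.
assert (a <> PI / 2) by (intros ->; now rewrite cos_PI2 in Hc). lra.
Qed.

(** [Carg] is defined by cases on the sign of [Im z], but near a point off the cut it agrees with
    the single arctangent formula, whose continuity is clear. *)
Lemma continuous_Clog (z : C) :
  0 < Cmod z + Re z -> continuous (T := C_UniformSpace) (U := C_UniformSpace) Clog z.
Proof.
intros H.
assert (Hm : 0 < Cmod z).
{ pose proof (re_le_Cmod z). pose proof (Rle_abs (Re z)). lra. }
assert (Hid := continuous_id (U := C_UniformSpace) z).
destruct (proj1 (continuous_C_iff (U := C_UniformSpace) (fun y => y) z) Hid) as [Hr Hi].
assert (Hs : continuous (T := C_UniformSpace) (fun y => Cmod y + Re y) z).
{ apply (continuous_plus (V := R_NormedModule)); [apply continuous_Cmod | exact Hr]. }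
apply (continuous_C_iff (U := C_UniformSpace)). cbn [Clog Re Im fst snd]. split.
- apply (continuous_comp (U := C_UniformSpace) Cmod ln);
    [apply continuous_Cmod | now apply continuous_ln].
- apply (continuous_ext_loc (T := C_UniformSpace) _
    (fun y => 2 * atan (Im y / (Cmod y + Re y)))).
  + assert (Ho := Hs _ (open_gt 0 _ H)). unfold filtermap in Ho. revert Ho.
    apply filter_imp.
    intros y Hy. symmetry. now apply Carg_atan.
  + apply (continuous_mult (K := R_AbsRing)); [apply continuous_const|].
    apply (continuous_comp (U := C_UniformSpace) _ atan); [|apply continuous_atan].
    apply (continuous_mult (K := R_AbsRing)); [exact Hi|].
    apply (continuous_comp (U := C_UniformSpace) _ Rinv); [exact Hs|].
    apply continuous_Rinv. lra.
Qed.

Lemma Cmod_plus_Re_pos (z : C) : 0 < Re z \/ Im z <> 0 -> 0 < Cmod z + Re z.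
Proof.
intros H. pose proof (Cmod_ge_0 z). pose proof (Cmod2_alt z).
destruct H as [H | H]; [lra|].
assert (0 < Im z ^ 2) by now apply pow2_gt_0. nra.
Qed.

Lemma Cmod_Clog_le (z : C) : z <> 0 -> Cmod (Clog z) <= Rabs (ln (Cmod z)) + PI.
Proof.
intros Hz. eapply Rle_trans; [apply Cmod_le_Rabs_plus|]. cbn [Clog Re Im fst snd].
apply Rplus_le_compat_l. apply Rabs_le. pose proof (Carg_bound z Hz). lra.
Qed.

Lemma Ccos_vline (c t : R) : Ccos (c, t) = (cos c * cosh t, - (sin c * sinh t)).
Proof.
unfold Ccos, Cexp, Ci, cosh, sinh.
apply injective_projections; cbn; rewrite ?cos_neg, ?sin_neg.
- replace (0 * c - 1 * t) with (- t) by ring. replace (0 * t + 1 * c) with c by ring.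
  rewrite Ropp_involutive. field.
- replace (0 * c - 1 * t) with (- t) by ring. replace (0 * t + 1 * c) with c by ring.
  rewrite Ropp_involutive. field.
Qed.

(** With [A], [B] the exponentials of [Ci * z] and its opposite, [A * B = 1] makes both sides equal
    to [A * A + B * B + 1]. *)
Lemma one_plus_2_Ccos_double (z : C) :
  (1 + 2 * Ccos (2 * z) = (2 * Ccos z - 1) * (2 * Ccos z + 1))%C.
Proof.
unfold Ccos.
replace (Ci * (2 * z))%C with (Ci * z + Ci * z)%C by ring.
rewrite Copp_plus_distr, !Cexp_plus.
assert (E : (Cexp (Ci * z) * Cexp (- (Ci * z)) = 1)%C).
{ rewrite <- Cexp_plus, Cplus_opp_r. unfold Cexp; cbn.
  rewrite exp_0, cos_0, sin_0. apply injective_projections; cbn; ring. }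
set (A := Cexp (Ci * z)) in *. set (B := Cexp (- (Ci * z))) in *.
transitivity (1 - 2 * (A * B) + 2 * (A * B) + (A * A + B * B))%C.
{ rewrite E. field. }
transitivity (A * A + 2 * (A * B) + B * B - 1)%C.
{ rewrite E. ring. }
field.
Qed.

(** * The integrand on a vertical line *)

(** The poles of F nearest to 0 are at plus and minus π/3, where the cosine is 1/2; the strict
    inequality is the margin by which the line avoids them. *)
Lemma cos_gt_half (c : R) : - (PI / 3) < c < PI / 3 -> / 2 < cos c.
Proof.
intros Hc. pose proof PI_RGT_0.
assert (E : cos (Rabs c) = cos c) by (unfold Rabs; destruct Rcase_abs; rewrite ?cos_neg; reflexivity).
rewrite <- E. replace (/ 2) with (cos (PI / 3)) by (rewrite cos_PI3; lra).
assert (0 <= Rabs c < PI / 3) by (split; [apply Rabs_pos | apply Rabs_def1; lra]).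
apply cos_decreasing_1; lra.
Qed.

Lemma cosh_ge_exp_Rabs (t : R) : exp (Rabs t) <= 2 * cosh t.
Proof.
unfold cosh, Rabs. pose proof (exp_pos t). pose proof (exp_pos (- t)).
destruct Rcase_abs; lra.
Qed.

Lemma cosh_ge_1 (t : R) : 1 <= cosh t.
Proof.
unfold cosh. pose proof (exp_ineq1_le t). pose proof (exp_ineq1_le (- t)). lra.
Qed.

(** The factor [Cmod (Ccos (c, t))] is kept to cancel the numerator of F. With [w] this cosine,
    [cosh t >= 1] gives |2w - 1| >= (2 cos c - 1) cosh t, and [Re w > 0] gives |2w + 1| >= 2|w|. *)
Lemma Cmod_denominator_ge (c t : R) : / 2 < cos c ->
  (2 * cos c - 1) * exp (Rabs t) * Cmod (Ccos (c, t)) <= Cmod (1 + 2 * Ccos (2 * (c, t)))%C.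
Proof.
intros Hc. rewrite one_plus_2_Ccos_double, Cmod_mult.
pose proof (cosh_ge_exp_Rabs t) as He. pose proof (cosh_ge_1 t) as H1.
assert (Hre : Re (Ccos (c, t)) = cos c * cosh t) by now rewrite Ccos_vline.
set (w := Ccos (c, t)) in *. clearbody w.
pose proof (Cmod_ge_0 w).
assert (Hm : (2 * cos c - 1) * cosh t <= Cmod (2 * w - 1)%C).
{ eapply Rle_trans; [|eapply Rle_trans; [apply Rle_abs | apply re_le_Cmod]].
  destruct w as [x y]. cbn in *. rewrite Hre. nra. }
assert (Hp : 2 * Cmod w <= Cmod (2 * w + 1)%C).
{ apply Rsqr_incr_0; [|lra|apply Cmod_ge_0].
  rewrite !Rsqr_pow2, Rpow_mult_distr, !Cmod2_alt.
  destruct w as [x y]. cbn in *. rewrite Hre. nra. }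
replace ((2 * cos c - 1) * exp (Rabs t) * Cmod w)
  with ((2 * cos c - 1) * (exp (Rabs t) / 2) * (2 * Cmod w)) by field.
pose proof (exp_pos (Rabs t)).
apply Rmult_le_compat; try nra.
Qed.

Lemma Ccos_vline_neq_0 (c t : R) : / 2 < cos c -> Ccos (c, t) <> 0.
Proof.
intros Hc E. rewrite Ccos_vline in E. apply (f_equal Re) in E. cbn in E.
pose proof (cosh_ge_1 t). nra.
Qed.

Lemma F_denominator_neq_0 (c t : R) : / 2 < cos c -> (1 + 2 * Ccos (2 * (c, t)))%C <> 0.
Proof.
intros Hc. apply Cmod_gt_0.
eapply Rlt_le_trans; [|now apply Cmod_denominator_ge].
assert (H := proj1 (Cmod_gt_0 _) (Ccos_vline_neq_0 c t Hc)).
pose proof (exp_pos (Rabs t)).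
repeat apply Rmult_lt_0_compat; lra.
Qed.

Lemma Cmod_F_le (c t : R) : / 2 < cos c ->
  Cmod (F (c, t)) <= 4 * sqrt 3 / (2 * cos c - 1) * exp (- Rabs t).
Proof.
intros Hc. unfold F.
rewrite Cmod_opp, Cmod_div by now apply F_denominator_neq_0.
rewrite !Cmod_mult, !Cmod_R, (Rabs_pos_eq 4), (Rabs_pos_eq (sqrt 3)) by (try apply sqrt_pos; lra).
assert (Hw := proj1 (Cmod_gt_0 _) (Ccos_vline_neq_0 c t Hc)).
assert (Hd := Cmod_denominator_ge c t Hc).
assert (H0 := proj1 (Cmod_gt_0 _) (F_denominator_neq_0 c t Hc)).
apply Rle_div_l; [exact H0|].
rewrite exp_Ropp. pose proof (exp_pos (Rabs t)).
apply Rmult_le_compat_l with (r := 4 * sqrt 3 / (2 * cos c - 1) * / exp (Rabs t)) in Hd.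
2: { apply Rmult_le_pos; [apply Rdiv_le_0_compat|];
     [pose proof (sqrt_pos 3) | | left; apply Rinv_0_lt_compat]; lra. }
eapply Rle_trans; [|exact Hd]. right. field. lra.
Qed.

Lemma continuous_vline (c t : R) : continuous (U := C_UniformSpace) (fun t => (c, t)) t.
Proof.
apply continuous_C_iff. cbn. split; [apply continuous_const | apply continuous_id].
Qed.

Lemma continuous_F_vline (c t : R) : / 2 < cos c ->
  continuous (U := C_UniformSpace) (fun t => F (c, t)) t.
Proof.
intros Hc. unfold F, Cdiv.
apply continuous_Copp, continuous_Cmult.
- apply continuous_Cmult; [apply continuous_const|]. apply continuous_Ccos, continuous_vline.
- apply continuous_Cinv; [|now apply F_denominator_neq_0].
  apply continuous_Cplus; [apply continuous_const|].
  apply continuous_Cmult; [apply continuous_const|].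
  apply continuous_Ccos, continuous_Cmult; [apply continuous_const | apply continuous_vline].
Qed.

(** * The function u on the line and the growth of its logarithm *)

Lemma u_vline (c t : R) :
  u (c, t) = (((PI - 3 * c) * (2 * PI - 3 * c) - 9 * t ^ 2) / (6 * PI ^ 2),
              - (9 * (PI - 2 * c) * t) / (6 * PI ^ 2)).
Proof.
pose proof PI_RGT_0 as HP. unfold u.
replace (6 * PI ^ 2)%C with (RtoC (6 * PI ^ 2)) by now rewrite RtoC_mult, RtoC_pow.
assert (6 * PI ^ 2 <> 0) by nra.
unfold Cdiv. rewrite <- RtoC_inv by assumption.
apply injective_projections; cbn; field; nra.
Qed.

(** As [c < PI / 2], the imaginary part of u vanishes only at [t = 0], where both linear factors are
    positive because [c < PI / 3]. *)
Lemma u_vline_slit (c t : R) : - (PI / 3) < c < PI / 3 ->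
  0 < Cmod (u (c, t)) + Re (u (c, t)).
Proof.
intros Hc. pose proof PI_RGT_0 as HP. apply Cmod_plus_Re_pos. rewrite u_vline. cbn [Re Im fst snd].
assert (0 < / (6 * PI ^ 2)) by (apply Rinv_0_lt_compat; nra).
destruct (Req_dec t 0) as [-> | Ht].
- left. apply Rmult_lt_0_compat; [|assumption]. nra.
- right. unfold Rdiv. apply Rmult_integral_contrapositive_currified; [|lra].
  apply Ropp_neq_0_compat, Rmult_integral_contrapositive_currified; [lra | exact Ht].
Qed.

Lemma Cmod_u_vline (c t : R) :
  Cmod (u (c, t)) = Cmod (PI - 3 * c, - 3 * t) * Cmod (2 * PI - 3 * c, - 3 * t) / (6 * PI ^ 2).
Proof.
pose proof PI_RGT_0 as HP. unfold u.
replace (6 * PI ^ 2)%C with (RtoC (6 * PI ^ 2)) by now rewrite RtoC_mult, RtoC_pow.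
assert (0 < 6 * PI ^ 2) by nra.
rewrite Cmod_div, Cmod_mult, Cmod_R, Rabs_pos_eq; [|lra|].
2: { intros E. apply RtoC_inj in E. lra. }
f_equal. f_equal; f_equal; apply injective_projections; cbn; ring.
Qed.

Lemma Cmod_u_vline_ge (c t : R) : - (PI / 3) < c < PI / 3 ->
  (PI - 3 * c) * (2 * PI - 3 * c) / (6 * PI ^ 2) <= Cmod (u (c, t)).
Proof.
intros Hc. rewrite Cmod_u_vline. pose proof PI_RGT_0.
assert (H1 := re_le_Cmod (PI - 3 * c, - 3 * t)).
assert (H2 := re_le_Cmod (2 * PI - 3 * c, - 3 * t)).
cbn [Re fst] in *. rewrite Rabs_pos_eq in H1, H2 by lra.
apply Rmult_le_compat_r; [left; apply Rinv_0_lt_compat; nra|].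
apply Rmult_le_compat; lra.
Qed.

Lemma Cmod_u_vline_le (c t : R) : - (PI / 3) < c < PI / 3 ->
  Cmod (u (c, t)) <= 3 / 2 * (1 + Rabs t) ^ 2.
Proof.
intros Hc. rewrite Cmod_u_vline. pose proof PI_RGT_0.
assert (H3 : 3 * Rabs t <= 3 * PI * Rabs t).
{ pose proof (Rabs_pos t). pose proof PI2_1. nra. }
assert (Hi : Rabs (- 3 * t) = 3 * Rabs t).
{ rewrite Rabs_mult, (Rabs_left (- 3)); lra. }
assert (H1 := Cmod_le_Rabs_plus (PI - 3 * c, - 3 * t)).
assert (H2 := Cmod_le_Rabs_plus (2 * PI - 3 * c, - 3 * t)).
cbn [Re Im fst snd] in *. rewrite Rabs_pos_eq in H1, H2 by lra.
assert (0 < 6 * PI ^ 2) by nra.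
apply Rle_div_l; [assumption|].
(* For [c > - (PI / 3)] the real parts of the linear factors are below [2 * PI] and [3 * PI], so
   each factor is at most [3 * PI * (1 + Rabs t)]. *)
replace (3 / 2 * (1 + Rabs t) ^ 2 * (6 * PI ^ 2))
  with ((3 * PI * (1 + Rabs t)) * (3 * PI * (1 + Rabs t))) by field.
apply Rmult_le_compat; try apply Cmod_ge_0; lra.
Qed.

Lemma Cmod_Clog_u_vline_le (c : R) : - (PI / 3) < c < PI / 3 ->
  exists B, forall t, Cmod (Clog (u (c, t))) <= B + 2 * ln (1 + Rabs t).
Proof.
intros Hc. pose proof PI_RGT_0.
set (m := (PI - 3 * c) * (2 * PI - 3 * c) / (6 * PI ^ 2)).
assert (Hm : 0 < m) by (unfold m; apply Rdiv_lt_0_compat; nra).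
(* The 1 covers ln(3/2) from the upper bound on |u|, [Rabs (ln m)] the lower bound, and [PI] the
   argument. *)
exists (1 + Rabs (ln m) + PI). intros t.
assert (Hl := Cmod_u_vline_ge c t Hc). fold m in Hl.
assert (Hu := Cmod_u_vline_le c t Hc).
pose proof (Rabs_pos t) as Ht.
eapply Rle_trans; [apply Cmod_Clog_le; apply Cmod_gt_0; lra|].
assert (E1 : ln m <= ln (Cmod (u (c, t)))) by (apply ln_le; lra).
assert (E2 : ln (Cmod (u (c, t))) <= 1 + 2 * ln (1 + Rabs t)).
{ rewrite <- (ln_exp (1 + 2 * ln (1 + Rabs t))). apply ln_le; [lra|].
  eapply Rle_trans; [exact Hu|].
  replace (1 + 2 * ln (1 + Rabs t)) with (1 + ln (1 + Rabs t) + ln (1 + Rabs t)) by ring.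
  rewrite !exp_plus, exp_ln by lra. pose proof (exp_ineq1_le 1). nra. }
assert (E3 : 0 <= ln (1 + Rabs t)) by (rewrite <- ln_1; apply ln_le; lra).
pose proof (Rle_abs (ln m)). pose proof (Rle_abs (- ln m)). rewrite Rabs_Ropp in *.
assert (Rabs (ln (Cmod (u (c, t)))) <= 1 + 2 * ln (1 + Rabs t) + Rabs (ln m)).
{ apply Rabs_le. lra. }
lra.
Qed.

(** This is ln y <= y - 1 at y = (1+x)/N, rescaled so that any multiple of the logarithm grows at
    most with slope 1. *)
Lemma ln_le_linear (N x : R) : 0 < N -> 0 <= x -> N * ln (1 + x) <= x + (1 + N * ln N).
Proof.
intros HN Hx.
assert (E : ln ((1 + x) / N) <= (1 + x) / N - 1).
{ assert (0 < (1 + x) / N) by (apply Rdiv_lt_0_compat; lra).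
  pose proof (exp_ineq1_le (ln ((1 + x) / N))) as H1. rewrite exp_ln in H1 by assumption. lra. }
rewrite ln_div in E by lra.
apply Rmult_le_compat_l with (r := N) in E; [|lra].
replace (N * ((1 + x) / N - 1)) with (1 + x - N) in E by (field; lra). lra.
Qed.

Lemma exp_minus_le_Cauchy (B S : R) : 0 <= S ->
  exists K, forall t, exp (- Rabs t) * exp (S * (B + 2 * ln (1 + Rabs t))) <= K * / (1 + t ^ 2).
Proof.
intros HS.
(* The exponential supplies [2 * S] logarithms and [1 + t ^ 2 <= (1 + Rabs t) ^ 2] two more; with
   [N = 2 * S + 2] their linear bound cancels [- Rabs t] exactly, leaving this constant. *)
exists (exp (S * B + (1 + (2 * S + 2) * ln (2 * S + 2)))). intros t.
pose proof (Rabs_pos t) as Ht.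
assert (H1 : 0 < 1 + t ^ 2) by nra.
assert (E : 1 + t ^ 2 <= exp (2 * ln (1 + Rabs t))).
{ replace (2 * ln (1 + Rabs t)) with (ln (1 + Rabs t) + ln (1 + Rabs t)) by ring.
  rewrite exp_plus, exp_ln by lra. rewrite <- (pow2_abs t). nra. }
apply (Rle_div_r _ _ (1 + t ^ 2)); [exact H1|].
rewrite <- exp_plus.
eapply Rle_trans; [apply Rmult_le_compat_l; [left; apply exp_pos | exact E]|].
rewrite <- exp_plus. apply exp_increasing_le.
pose proof (ln_le_linear (2 * S + 2) (Rabs t)) as H. lra.
Qed.

Lemma F_vline_log_bound (c : R) (hc : - (PI / 3) < c < PI / 3) (S : R) :
  exists K, forall t, Cmod (F (c, t)) * exp (S * Cmod (Clog (u (c, t)))) <= K * / (1 + t ^ 2).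
Proof.
assert (Hcos := cos_gt_half c hc).
destruct (Cmod_Clog_u_vline_le c hc) as [B HB].
(* Passing to [Rabs S] gives the required nonnegative exponent and only enlarges the majorant. *)
destruct (exp_minus_le_Cauchy B (Rabs S) (Rabs_pos S)) as [K HK].
set (A := 4 * sqrt 3 / (2 * cos c - 1)).
assert (HA : 0 <= A).
{ unfold A. apply Rdiv_le_0_compat; [pose proof (sqrt_pos 3)|]; lra. }
exists (A * K). intros t.
rewrite Rmult_assoc. eapply Rle_trans; [|apply Rmult_le_compat_l; [exact HA | apply HK]].
rewrite <- Rmult_assoc.
apply Rmult_le_compat; [apply Cmod_ge_0 | left; apply exp_pos | now apply Cmod_F_le |].
apply exp_increasing_le.
apply Rle_trans with (Rabs S * Cmod (Clog (u (c, t)))).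
- apply Rmult_le_compat_r; [apply Cmod_ge_0 | apply Rle_abs].
- apply Rmult_le_compat_l; [apply Rabs_pos | apply HB].
Qed.

Theorem theorem2p2 (c : R) (hc : - (PI / 3) < c < PI / 3) :
  (forall s : C, ex_vline_int c (Dstar_integrand s)) /\ entire (Dstar c).
Proof.
destruct (entire_RInt_gen_Cexp (fun t => F (c, t)) (fun t => Clog (u (c, t)))
  (* The prefactor 1/(2πi) is merged with the [Ci] coming from dz = i dt. *)
  (/ (2 * PI * Ci) * Ci)%C) as [Hex Hent].
- intros t. apply continuous_F_vline, cos_gt_half, hc.
- intros t. apply (continuous_comp (V := C_UniformSpace) (W := C_UniformSpace)
    (fun t => u (c, t)) Clog).
  + apply continuous_C_iff.
    split; eapply continuous_ext; try (intros y; rewrite u_vline; reflexivity); cbn [Re Im fst snd];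
      apply (ex_derive_continuous (V := R_NormedModule)); auto_derive; exact I.
  + apply continuous_Clog, u_vline_slit, hc.
- apply F_vline_log_bound, hc.
- split; [exact Hex|].
  intros s. eapply ex_derive_ext; [|apply (Hent s)].
  intros s'. symmetry. apply Cmult_assoc.
Qed.
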